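(* Let $\mathcal{X},\mathcal{Y}_1,\dots,\mathcal{Y}_m$ be measurable spaces, $m$ a positive integer. Fix a probability measure $Q_X$ on $\mathcal{X}$, a real number $d\in\mathbb{R}$, and for each $j\in\{1,\dots,m\}$ a random transformation (Markov kernel) $Q_{Y_j|X}$ from $\mathcal{X}$ to $\mathcal{Y}_j$, a probability measure $R_{Y_j}$ on $\mathcal{Y}_j$, and a constant $c_j\in(0,\infty)$. Let $(X,Y_j)\sim Q_XQ_{Y_j|X}$ for each $j$. Then the following two statements are equivalent: 1) For all non-negative measurable functions $f_j\colon\mathcal{Y}_j\to\mathbb{R}$, $j=1,\dots,m$, $$\mathbb{E}\left[\exp\left(\sum_{j=1}^m\mathbb{E}[\log f_j(Y_j)\,|\,X]-d\right)\right]\le\prod_{j=1}^m\|f_j\|_{\frac{1}{c_j}}.$$ 2) For every probability measure $P_X\ll Q_X$ on $\mathcal{X}$, $$D(P_X\|Q_X)+d\ \ge\ \sum_{j=1}^m c_j\,D(P_{Y_j}\|R_{Y_j}),$$ where $P_{Y_j}$ is the distribution on $\mathcal{Y}_j$ obtained by passing $P_X$ through $Q_{Y_j|X}$.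
   Context: $\|f_j\|_{1/c_j}:=\left(\int f_j^{1/c_j}\,\mathrm{d}R_{Y_j}\right)^{c_j}$ (possibly $+\infty$). For probability measures $P,Q$ on the same space, $D(P\|Q):=\mathbb{E}_P\left[\log\frac{\mathrm{d}P}{\mathrm{d}Q}\right]$ if $P\ll Q$, and $D(P\|Q):=+\infty$ otherwise. The output distribution is $P_{Y_j}(B)=\int Q_{Y_j|X}(B|x)\,\mathrm{d}P_X(x)$. The conditional expectation $\mathbb{E}[\log f_j(Y_j)|X=x]$ is $\int\log f_j\,\mathrm{d}Q_{Y_j|X=x}$. Conventions: natural logarithm, $\log 0=-\infty$, $\exp(-\infty)=0$; statement 1) is required for those $(f_j)$ for which both sides are well defined in the extended reals (no $\infty-\infty$ or $0\cdot\infty$). *)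

(* Defs.v *)
From HB Require Import structures.
From mathcomp Require Import all_boot all_order all_algebra.
From mathcomp Require Import all_classical all_reals all_analysis.

Set Implicit Arguments.
Unset Strict Implicit.
Unset Printing Implicit Defensive.

Import Order.TTheory GRing.Theory Num.Theory.
Import numFieldNormedType.Exports.

Local Open Scope classical_set_scope.
Local Open Scope ring_scope.
Local Open Scope ereal_scope.

(* [lne] is the extended logarithm, with [lne 0 = -oo]; the derivative is taken
   of P, viewed as a charge, with respect to Q. *)
Definition kl_divergence {d} {T : measurableType d} {R : realType}
    (P Q : probability T R) : \bar R :=
  if pselect (P `<< Q) is left _
  then \int[P]_x lne (Radon_Nikodym (charge_of_finite_measure P) Q x)
  else +oo.

Definition output_distribution {d d'} {X : measurableType d}
    {Y : measurableType d'} {R : realType}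
    (P : probability X R) (k : R.-pker X ~> Y) (B : set Y) : \bar R :=
  \int[P]_x k x B.

Section output_distribution_probability.
Context d d' (X : measurableType d) (Y : measurableType d') (R : realType).
Variables (P : probability X R) (k : R.-pker X ~> Y).

Let output0 : output_distribution P k set0 = 0.
Proof. by rewrite /output_distribution integral0_eq. Qed.

Let output_ge0 B : 0 <= output_distribution P k B.
Proof. exact: integral_ge0. Qed.

Let output_sigma_additive : semi_sigma_additive (output_distribution P k).
Proof.
move=> U mU tU mUU; rewrite [X in _ --> X](_ : _ =
  \int[P]_x (\sum_(n <oo) k x (U n))); last first.
  apply: eq_integral => x _.
  by apply/esym/cvg_lim => //; exact/measure_semi_sigma_additive.
apply/cvg_closeP; split.
  by apply: is_cvg_nneseries => n _ _; exact: integral_ge0.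
rewrite closeE// integral_nneseries// => n.
exact: measurable_kernel.
Qed.

HB.instance Definition _ := isMeasure.Build _ _ _ (output_distribution P k)
  output0 output_ge0 output_sigma_additive.

Let output_setT : output_distribution P k setT = 1.
Proof.
rewrite /output_distribution; under eq_integral do rewrite prob_kernel.
by rewrite (integral_cst P measurableT) mul1e; exact: probability_setT.
Qed.

HB.instance Definition _ :=
  Measure_isProbability.Build _ _ _ (output_distribution P k) output_setT.

End output_distribution_probability.

(* [cond_log k f x] is E[log f(Y) | X = x] for Y distributed as [k x]. *)
Definition cond_log {d d'} {X : measurableType d} {Y : measurableType d'}
    {R : realType} (k : R.-pker X ~> Y) (f : Y -> R) (x : X) : \bar R :=
  \int[k x]_y lne (f y)%:E.

(* The library integral is \int g^+ - \int g^- and is total; this says that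
   the difference is not of the form oo - oo. *)
Definition integral_defined {d} {T : measurableType d} {R : realType}
    (mu : {measure set T -> \bar R}) (g : T -> \bar R) : Prop :=
  (\int[mu]_x g^\+ x) +? - (\int[mu]_x g^\- x).

(* A finite sum (resp. product) of extended reals is well defined when no two
   of its terms are +oo and -oo (resp. 0 and infinite). *)
Definition sum_defined {R : realType} {m : nat} (a : 'I_m -> \bar R) : Prop :=
  forall i j, a i +? a j.

Definition prod_defined {R : realType} {m : nat} (a : 'I_m -> \bar R) : Prop :=
  forall i j, a i *? a j.

(* Main.v *)
Require Import Defs.
From HB Require Import structures.
From mathcomp Require Import all_boot all_order all_algebra.
From mathcomp Require Import all_classical all_reals all_analysis.
From mathcomp Require Import measurable_realfun lra.

(** Both inequalities are equivalent to their common restriction to bounded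
functions: for all bounded measurable g_j,
  E exp (sum_j c_j E[g_j(Y_j) | X] - d) <= prod_j (E_{R_j} exp g_j)^{c_j}.
One gets it from 1) with f_j = exp (c_j g_j).  It gives 2) because a divergence
D(P||R) is the supremum of E_P g over bounded g with E_R e^g <= 1, and because
D(P||Q) >= E_P phi - log E_Q e^phi for the bounded exponent phi.  Conversely, 2)
applied to the tilted measure dP/dQ proportional to e^phi gives back the bounded
inequality.  Finally 1) follows by clipping log f_j to [-c_j b, n], letting
first b and then n go to infinity: the integral of min(log f_j, n) converges to
that of log f_j even when the latter is infinite or of the form oo - oo, which
is -oo by the library's convention. *)

Set Implicit Arguments.
Unset Strict Implicit.
Unset Printing Implicit Defensive.

Import Order.TTheory GRing.Theory Num.Theory.
Import numFieldNormedType.Exports.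

Local Open Scope classical_set_scope.
Local Open Scope ring_scope.
Local Open Scope ereal_scope.

(** * Extended reals *)

Section extended_real_integrals.
Context d (T : measurableType d) (R : realType).
Implicit Types (mu : {measure set T -> \bar R}) (f g : T -> \bar R).

(** Holds without integrability: almost everywhere [f^\+ <= g^\+] and [g^\- <= f^\-], and
    subtraction in [\bar R] stays monotone when [oo - oo] is read as [-oo]. *)
Lemma ae_le_integral mu f g :
  measurable_fun [set: T] f -> measurable_fun [set: T] g ->
  {ae mu, forall x, f x <= g x} -> \int[mu]_x f x <= \int[mu]_x g x.
Proof.
move=> mf mg fg; rewrite integralE [leRHS]integralE; apply: leeB.
- apply: ae_ge0_le_integral => //; [exact: measurable_funepos..|].
  apply: filterS fg => x fgx _; rewrite !funeposE ge_max !le_max fgx/=.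
  by rewrite lexx orbT.
- apply: ae_ge0_le_integral => //; [exact: measurable_funeneg..|].
  apply: filterS fg => x fgx _; rewrite !funenegE ge_max !le_max leeN2 fgx/=.
  by rewrite lexx orbT.
Qed.

Lemma cvg_mine (x : \bar R) : -oo < x ->
  mine x n%:R%:E @[n --> \oo] --> x.
Proof.
move: x => [r _|_|//].
- apply: cvg_near_cst; near=> n; apply/eqP; rewrite eq_minl lee_fin.
  by near: n; exact: nbhs_infty_ger.
- apply/cvgeyPge => A; near=> n; rewrite min_r ?leey// lee_fin.
  by near: n; exact: nbhs_infty_ger.
Unshelve. all: by end_near. Qed.

(** Truncation from above leaves [f^\-] unchanged, so monotone convergence applied to [f^\+] is
    enough. *)
Lemma cvg_integral_mine mu f : measurable_fun [set: T] f ->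
  \int[mu]_x mine (f x) n%:R%:E @[n --> \oo] --> \int[mu]_x f x.
Proof.
move=> mf.
have posE n x : (fun x => mine (f x) n%:R%:E)^\+ x = mine (f^\+ x) n%:R%:E.
  by rewrite !funeposE max_minl (max_l (_ : 0 <= n%:R%:E))// lee_fin.
have negE n x : (fun x => mine (f x) n%:R%:E)^\- x = f^\- x.
  rewrite !funenegE oppe_min -maxA (max_r (_ : - n%:R%:E <= 0))//.
rewrite [X in _ --> X]integralE.
have -> : (fun n => \int[mu]_x mine (f x) n%:R%:E) =
    (fun n => \int[mu]_x mine (f^\+ x) n%:R%:E - \int[mu]_x f^\- x).
  apply/funext => n; rewrite integralE.
  by congr (_ - _); apply: eq_integral => x _; rewrite ?posE ?negE.
(* If the negative part has infinite integral, both sides are [-oo] by convention, whatever the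
   positive part is. *)
have [->|fn] := eqVneq (\int[mu]_x f^\- x) +oo.
  by rewrite addeNy; under eq_fun do rewrite addeNy; exact: cvg_cst.
have fnfin : \int[mu]_x f^\- x \is a fin_num.
  by rewrite ge0_fin_numE ?ltey//; exact: integral_ge0.
apply: cvgeB; [by rewrite fin_num_adde_defl ?fin_numN|idtac|exact: cvg_cst].
have -> : \int[mu]_x f^\+ x = \int[mu]_x limn (fun n => mine (f^\+ x) n%:R%:E).
  apply: eq_integral => x _; apply/esym/cvg_lim => //; apply: cvg_mine.
  exact: lt_le_trans (funepos_ge0 _ _).
apply: cvg_monotone_convergence => //.
- by move=> n; apply: measurable_mine => //; exact: measurable_funepos.
- by move=> n x _; rewrite le_min funepos_ge0 lee_fin/=.
- move=> x _ a b ab; rewrite le_min ge_min lexx ge_min lee_fin ler_nat ab.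
  by rewrite orbT.
Qed.

End extended_real_integrals.

Section extended_exp_log.
Context (R : realType).

Lemma measurable_expeR : measurable_fun [set: \bar R] (@expeR R).
Proof.
have -> : @expeR R = fun x => if x == +oo then +oo else
    if x == -oo then 0 else (expR (fine x))%:E.
  by apply/funext; case=> [r| |].
apply: measurable_fun_ifT => //; first exact: measurable_fun_eqe.
apply: measurable_fun_ifT => //; first exact: measurable_fun_eqe.
by apply/measurable_EFinP; apply: measurableT_comp => //; exact: fine_measurable.
Qed.

Lemma measurable_lne : measurable_fun [set: \bar R] (@lne R).
Proof.
have -> : @lne R = fun x => if x == +oo then +oo else
    if (fine x <= 0)%R then -oo else (ln (fine x))%:E.
  by apply/funext; case=> [r| |] //=; rewrite lexx.
apply: measurable_fun_ifT => //; first exact: measurable_fun_eqe.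
apply: measurable_fun_ifT => //.
  by apply: measurable_fun_ler => //; exact: fine_measurable.
by apply/measurable_EFinP; apply: measurableT_comp => //; exact: fine_measurable.
Qed.

(** [expeR] is an order isomorphism of [\bar R] onto [[0, +oo]], so it preserves suprema of
    nondecreasing sequences, infinite values included. *)
Lemma cvg_expeR (u : (\bar R)^nat) (x : \bar R) :
  {homo u : n m / (n <= m)%N >-> n <= m} -> u n @[n --> \oo] --> x ->
  expeR (u n) @[n --> \oo] --> expeR x.
Proof.
move=> nd_u ux.
have nd_eu : {homo (expeR \o u) : n m / (n <= m)%N >-> n <= m}.
  by move=> n m nm /=; rewrite lee_expeR nd_u.
have cu := ereal_nondecreasing_is_cvgn nd_eu.
suff -> : expeR x = limn (expeR \o u) by [].
apply/eqP; rewrite eq_le; apply/andP; split; last first.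
  apply: lime_le => //; apply: nearW => n /=; rewrite lee_expeR.
  move: ux => /cvg_lim <- //; apply: lime_ge.
    exact: ereal_nondecreasing_is_cvgn.
  by near=> m; apply: nd_u; near: m; exists n.
(* The limit is nonnegative, hence of the form [expeR y]; comparing exponents, [y] bounds every
   [u n] and therefore [x]. *)
have L0 : 0 <= limn (expeR \o u).
  by apply: lime_ge => //; apply: nearW => n; exact: expeR_ge0.
have [y yL] := expeR_total L0.
rewrite -yL lee_expeR; move: (ux) => /cvg_lim <- //; apply: lime_le.
  exact: ereal_nondecreasing_is_cvgn.
apply: nearW => n; rewrite -lee_expeR yL; apply: lime_ge => //.
by near=> m; apply: nd_eu; near: m; exists n.
Unshelve. all: by end_near. Qed.

Lemma cvge_sum (I : Type) (r : seq I) (u : I -> (\bar R)^nat) (a : I -> \bar R) :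
  (forall i, -oo < a i) -> (forall i, u i n @[n --> \oo] --> a i) ->
  \sum_(i <- r) u i n @[n --> \oo] --> \sum_(i <- r) a i.
Proof.
(* The induction also carries that the sum of the limits is not [-oo], which rules out [oo - oo]
   when the next limit is added. *)
move=> a_gt u_a; suff [] : (-oo < \sum_(i <- r) a i) /\
  (\sum_(i <- r) u i n @[n --> \oo] --> \sum_(i <- r) a i) by [].
elim: r => [|i r [IHgt IH]].
  by rewrite big_nil; under eq_fun do rewrite big_nil; split; [|exact: cvg_cst].
rewrite big_cons; split.
  by case: (a i) (a_gt i) => [?| |]//; case: (\sum_(j <- r) a j) IHgt => [?| |]//;
    rewrite -?EFinD ?ltNyr.
by under eq_fun do rewrite big_cons; apply: cvgeD => //;
  apply: ltninfty_adde_def; rewrite inE.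
Qed.

End extended_exp_log.

(** * Densities and divergence *)

(** A version of dP/dQ that is real and nonnegative at every point, so that [lne (h x)%:E] can be
    handled pointwise. *)
Definition is_density d (T : measurableType d) (R : realType)
    (P Q : probability T R) (h : T -> R) :=
  [/\ measurable_fun [set: T] h, forall x, (0 <= h x)%R &
      forall A, measurable A -> P A = \int[Q]_(x in A) (h x)%:E].

Section density.
Context d (T : measurableType d) (R : realType).
Implicit Types (P Q : probability T R) (h : T -> R).

Lemma measurable_lne_comp h : measurable_fun [set: T] h ->
  measurable_fun [set: T] (fun x => lne (h x)%:E).
Proof.
move=> mh; apply: (measurableT_comp (@measurable_lne R)).
exact/measurable_EFinP.
Qed.

Lemma density_integrable P Q h : is_density P Q h ->
  Q.-integrable [set: T] (EFin \o h).
Proof.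
move=> [mh h0 PE]; apply/integrableP; split; first exact/measurable_EFinP.
under eq_integral do rewrite /= ger0_norm//.
by rewrite -PE// probability_setT ltry.
Qed.

Lemma density_dominates P Q h : is_density P Q h -> P `<< Q.
Proof.
move=> dh; have [mh h0 PE] := dh; apply/null_content_dominatesP => A mA QA0.
rewrite PE//; apply: null_set_integral => //.
exact: measurable_funTS (measurable_int _ (density_integrable dh)).
Qed.

Lemma dominates_density P Q : P `<< Q -> exists h, is_density P Q h.
Proof.
move=> PQ; pose g := Radon_Nikodym_SigmaFinite.f P Q.
have g0 : forall x, 0 <= g x by exact: Radon_Nikodym_SigmaFinite.f_ge0.
have gfin x : g x \is a fin_num by exact: Radon_Nikodym_SigmaFinite.f_fin_num.
exists (fine \o g); split.
- apply: measurableT_comp; first exact: fine_measurable.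
  exact: measurable_int (Radon_Nikodym_SigmaFinite.f_integrable PQ).
- by move=> x; exact: fine_ge0.
- move=> A mA; rewrite (Radon_Nikodym_SigmaFinite.f_integral PQ mA).
  by apply: eq_integral => x _; rewrite /= fineK.
Qed.

(** Two densities with the same integral over every measurable set agree [Q]-almost everywhere, and
    domination carries this over to [P]. *)
Lemma kl_divergence_density P Q h : is_density P Q h ->
  kl_divergence P Q = \int[P]_x lne (h x)%:E.
Proof.
move=> dh; have PQ := density_dominates dh; have [mh h0 PE] := dh.
rewrite /kl_divergence; case: pselect => // PQ'.
have mRN : measurable_fun [set: T]
    (Radon_Nikodym (charge_of_finite_measure P) Q).
  exact: measurable_int (Radon_Nikodym_integrable _).
apply: ae_eq_integral => //.
- exact: measurableT_comp (@measurable_lne R) mRN.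
- exact: measurable_lne_comp.
- apply: (ae_eq_comp (@lne R)); apply: null_dominates_ae_eq PQ _ => //.
  apply/ae_eq_sym; apply: integral_ae_eq => //.
    exact: density_integrable dh.
  move=> E _ mE; rewrite -Radon_Nikodym_integral//=.
  by rewrite PE.
Qed.

Lemma integral_density P Q h (f : T -> \bar R) : is_density P Q h ->
  measurable_fun [set: T] f -> (forall x, 0 <= f x) ->
  \int[P]_x f x = \int[Q]_x (f x * (h x)%:E).
Proof.
move=> dh mf f0; have PQ := density_dominates dh; have [mh h0 PE] := dh.
rewrite -(Radon_Nikodym_SigmaFinite.change_of_variables PQ)//.
have ig := Radon_Nikodym_SigmaFinite.f_integrable PQ.
apply: ge0_ae_eq_integral => //.
- by apply: emeasurable_funM => //; exact: measurable_int ig.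
- by apply: emeasurable_funM => //; exact/measurable_EFinP.
- move=> x _; rewrite mule_ge0//.
  exact: Radon_Nikodym_SigmaFinite.f_ge0.
- by move=> x _; rewrite mule_ge0// lee_fin.
- apply: ae_eqe_mul2l; apply: integral_ae_eq => //; first exact/measurable_EFinP.
  move=> E _ mE; rewrite -(Radon_Nikodym_SigmaFinite.f_integral PQ)//.
  exact: PE.
Qed.

Lemma density_gt0 P Q h : is_density P Q h -> {ae P, forall x, (0 < h x)%R}.
Proof.
move=> [mh h0 PE]; exists [set x | (h x <= 0)%R].
have mh0 : measurable [set x | (h x <= 0)%R].
  by rewrite -[X in measurable X]setTI; exact: measurable_fun_le.
split => //; last by move=> x /= /negP; rewrite -leNgt.
rewrite PE// integral0_eq// => x /= hx.
by apply/eqP; rewrite eqe eq_le hx h0.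
Qed.

(** Integrate [ln t <= t - 1] at [t = F / h] against [P]: almost everywhere
    [ln F + 1 - F / h <= ln h]. The constant [F = 1] gives nonnegativity of the divergence, a
    normalized exponential gives its variational lower bound. *)
Lemma kl_divergence_ge P Q (F : T -> R) : measurable_fun [set: T] F ->
  (forall x, (0 <= F x)%R) -> P.-integrable [set: T] (fun x => lne (F x)%:E) ->
  \int[P]_x lne (F x)%:E + 1 - \int[Q]_x (F x)%:E <= kl_divergence P Q.
Proof.
move=> mF F0 iF.
have [PQ|nPQ] := pselect (P `<< Q); last first.
  by rewrite /kl_divergence; case: pselect => // *; rewrite leey.
have [h dh] := dominates_density PQ; have [mh h0 PE] := dh.
rewrite (kl_divergence_density dh).
(* [q] is [F / h] wherever [h > 0], written so that it is clearly measurable;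
   where [h = 0] the junk value [ln 0 = 0] makes it [F]. *)
pose q x := (F x * expR (- ln (h x)))%R.
have qE x : (0 < h x)%R -> q x = (F x / h x)%R.
  by move=> hx; rewrite /q expRN lnK.
have mq : measurable_fun [set: T] q.
  by apply: measurable_funM => //; do 2 apply: measurableT_comp => //;
    exact: measurableT_comp.
have q0 x : (0 <= q x)%R by rewrite mulr_ge0// expR_ge0.
have mqE : measurable_fun [set: T] (EFin \o q) by exact/measurable_EFinP.
(* Only an inequality, because [P] does not see the part of [F] carried by the set where [h = 0]. *)
have qF : \int[P]_x (q x)%:E <= \int[Q]_x (F x)%:E.
  rewrite (integral_density dh)//.
  apply: ge0_le_integral => //.
  - by move=> x _; rewrite mule_ge0// lee_fin.
  - by apply: emeasurable_funM => //; exact/measurable_EFinP.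
  - exact/measurable_EFinP.
  - move=> x _; rewrite -EFinM lee_fin.
    have [->|hx] := eqVneq (h x) 0%R; first by rewrite mulr0.
    by rewrite qE ?divfK// lt_neqAle eq_sym hx h0.
(* An infinite [Q]-integral makes the left side [-oo]; otherwise [q] is [P]-integrable and linearity
   applies. *)
have [Fy|Ffin] := eqVneq (\int[Q]_x (F x)%:E) +oo.
  by rewrite Fy addeNy leNye.
have iq : P.-integrable [set: T] (EFin \o q).
  apply/integrableP; split => //.
  under eq_integral do rewrite /= ger0_norm//.
  by rewrite (le_lt_trans qF)// ltey.
apply: (@le_trans _ _ (\int[P]_x (lne (F x)%:E + (1 - q x)%:E))).
  have i1 : P.-integrable [set: T] (EFin \o cst 1%R).
    exact: finite_measure_integrable_cst.
  have i1q : P.-integrable [set: T] (fun x => (1 - q x)%:E).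
    by have := integrableB measurableT i1 iq; apply: eq_integrable.
  rewrite integralD//.
  rewrite [X in _ <= _ + X](_ : _ = 1 - \int[P]_x (q x)%:E).
    by rewrite addeA leeB.
  under eq_integral do rewrite EFinB.
  rewrite integralB// integral_cst// mul1e; congr (_ - _).
  exact: probability_setT.
apply: ae_le_integral.
- apply: emeasurable_funD; first exact: measurable_lne_comp.
  by apply/measurable_EFinP; exact: measurable_funB.
- exact: measurable_lne_comp.
- apply: filterS (density_gt0 dh) => x hx.
  have [Fx|Fx] := leP (F x) 0%R.
    by rewrite le0_lneNy ?lee_fin// leNye.
  rewrite !lne_EFin// -EFinD lee_fin.
  have qx : (0 < q x)%R by rewrite qE// divr_gt0.
  have : (ln (q x) = ln (F x) - ln (h x))%R by rewrite qE// ln_div ?posrE.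
  have : (ln (1 + (q x - 1)) <= q x - 1)%R.
    by apply: le_ln1Dx; rewrite ltrBrDr addNr.
  by rewrite [X in ln X]addrC subrK => + lnq; rewrite lnq; lra.
Qed.

Lemma kl_divergence_ge0 P Q : 0 <= kl_divergence P Q.
Proof.
have lne_cst1 : (fun _ : T => lne 1%:E) = cst (0 : \bar R).
  by apply/funext => x; rewrite lne1.
have i0 : P.-integrable [set: T] (fun x => lne (cst 1%R x)%:E).
  by rewrite /= lne_cst1; exact: integrable0.
have := @kl_divergence_ge P Q (cst 1%R) (measurable_cst _) (fun=> ler01) i0.
rewrite /= lne_cst1 integral0 add0e integral_cst// mul1e.
by rewrite [X in 1 - X](_ : _ = 1) ?subee//; exact: probability_setT.
Qed.

End density.

(** * Variational formula for the divergence *)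

Section clip.
Context (R : realType).
Implicit Types (l n c : R) (x : \bar R).

Definition clip l n x : R := fine (maxe (- l)%:E (mine x n%:E)).

Lemma clipE l n x : (clip l n x)%:E = maxe (- l)%:E (mine x n%:E).
Proof.
rewrite /clip fineK// fin_numE; apply/andP; split.
  by rewrite gt_eqF// lt_max ltNyr.
by rewrite lt_eqF// gt_max ltry gt_min ltry orbT.
Qed.

Lemma measurable_clip l n : measurable_fun [set: \bar R] (clip l n).
Proof.
apply: measurableT_comp; first exact: fine_measurable.
by apply: measurable_maxe => //; exact: measurable_mine.
Qed.

Lemma clip_bounded l n x : (0 <= l)%R -> (0 <= n)%R ->
  (`|clip l n x| <= l + n)%R.
Proof.
move=> l0 n0; rewrite ler_norml -!lee_fin clipE le_max ge_max ge_min.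
by rewrite !lee_fin lerN2 lerDl n0/= orbC lerDr l0 andbT; lra.
Qed.

Lemma mine_le_clip l n x : mine x n%:E <= (clip l n x)%:E.
Proof. by rewrite clipE le_max lexx orbT. Qed.

(** If the lower bound is active, the exponential is exactly the additive error; otherwise the clip
    is a mere truncation from above. Clipping from below thus costs [exp (- l / c)], which vanishes
    as [l] grows. *)
Lemma expR_clip_le l n c x : (0 < c)%R ->
  (expR (c^-1 * clip l n x))%:E <=
  expeR (c^-1%:E * mine x n%:E) + (expR (- (c^-1 * l)))%:E.
Proof.
move=> c0; have [|] := leP (mine x n%:E) (- l)%:E => xl.
  have -> : clip l n x = (- l)%R by rewrite /clip max_l.
  by rewrite mulrN leeDr// expeR_ge0.
rewrite -[leLHS]/(expeR (c^-1%:E * (clip l n x)%:E)) clipE (max_r (ltW xl)).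
by rewrite leeDl// lee_fin expR_ge0.
Qed.

End clip.

Section bounded_functions.
Context d (T : measurableType d) (R : realType).
Implicit Types (mu : {measure set T -> \bar R}) (g : T -> R).

Definition bounded_measurable g :=
  measurable_fun [set: T] g /\ exists K, forall x, (`|g x| <= K)%R.

Lemma bounded_measurable_integrable mu g : mu [set: T] < +oo ->
  bounded_measurable g -> mu.-integrable [set: T] (EFin \o g).
Proof.
move=> muT [mg [K gK]]; apply: measurable_bounded_integrable => //.
exists K; split; first exact: num_real.
by move=> M KM x _; exact: le_trans (gK x) (ltW KM).
Qed.

Lemma bounded_measurable_cst r : bounded_measurable (cst r).
Proof. by split => //; exists `|r|%R. Qed.

Lemma bounded_measurableD g1 g2 : bounded_measurable g1 ->
  bounded_measurable g2 -> bounded_measurable (fun x => g1 x + g2 x)%R.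
Proof.
move=> [m1 [K1 b1]] [m2 [K2 b2]]; split; first exact: measurable_funD.
by exists (K1 + K2)%R => x; rewrite (le_trans (ler_normD _ _))// lerD.
Qed.

Lemma bounded_measurableZ r g : bounded_measurable g ->
  bounded_measurable (fun x => r * g x)%R.
Proof.
move=> [mg [K gK]]; split; first exact: measurable_funM.
by exists (`|r| * K)%R => x; rewrite normrM ler_wpM2l.
Qed.

Lemma bounded_measurable_sum (I : Type) (r : seq I) (g : I -> T -> R) :
  (forall i, bounded_measurable (g i)) ->
  bounded_measurable (fun x => \sum_(i <- r) g i x)%R.
Proof.
move=> bg; elim: r => [|i r IH].
  by under eq_fun do rewrite big_nil; exact: bounded_measurable_cst.
by under eq_fun do rewrite big_cons; exact: bounded_measurableD.
Qed.

Lemma bounded_measurable_expR g : bounded_measurable g ->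
  bounded_measurable (fun x => expR (g x)).
Proof.
move=> [mg [K gK]]; split; first exact: measurableT_comp.
exists (expR K) => x; rewrite ger0_norm ?expR_ge0// ler_expR.
exact: le_trans (ler_norm _) (gK x).
Qed.

Lemma integral_bounded_fin_num mu g : mu [set: T] < +oo ->
  bounded_measurable g -> \int[mu]_x (g x)%:E \is a fin_num.
Proof.
move=> muT bg; apply: integrable_fin_num => //.
exact: bounded_measurable_integrable.
Qed.

Lemma probabilityT_lty (P : probability T R) : P [set: T] < +oo.
Proof. by rewrite probability_setT ltry. Qed.

Lemma integral_probability_cst (P : probability T R) (r : R) :
  \int[P]_x r%:E = r%:E.
Proof.
rewrite integral_cst// [X in _ * X](_ : _ = 1) ?mule1//.
exact: probability_setT.
Qed.

Lemma integral_expR_gt0 (P : probability T R) g : bounded_measurable g ->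
  0 < \int[P]_x (expR (g x))%:E.
Proof.
move=> [mg [K gK]].
apply: (@lt_le_trans _ _ (expR (- K))%:E); first by rewrite lte_fin expR_gt0.
have <- := integral_probability_cst P (expR (- K)); apply: ge0_le_integral => //.
- by apply/measurable_EFinP; exact: measurableT_comp.
- move=> x _; rewrite lee_fin ler_expR.
  by have := gK x; rewrite ler_norml => /andP[].
Qed.

End bounded_functions.

Section kl_divergence_approx.
Context d (T : measurableType d) (R : realType).
Variables (P Q : probability T R).

(** A set [A] with [Q A = 0 < P A] is invisible to [Q]: a multiple of its indicator has exponential
    1 [Q]-almost everywhere, while its mean under [P] can be made arbitrarily large. *)
Let kl_approx_singular M : ~ P `<< Q -> exists g : T -> R,
  [/\ bounded_measurable g, \int[Q]_x (expR (g x))%:E <= 1 &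
      M%:E <= \int[P]_x (g x)%:E].
Proof.
move=> nPQ.
have [A [mA QA PA]] : exists A, [/\ measurable A, Q A = 0 & P A != 0].
  apply/not_existsP => H; apply: nPQ; apply/null_content_dominatesP => A mA QA.
  by apply/eqP; apply/negPn/negP => PA; apply: (H A).
have PAfin : P A \is a fin_num by exact: fin_num_measure.
have PA0 : (0 < fine (P A))%R.
  by rewrite fine_gt0// lt0e PA measure_ge0 ltey_eq PAfin.
(* Chosen so that [K * P A] equals the absolute value of [M]. *)
pose K := (`|M| / fine (P A))%R.
have K0 : (0 <= K)%R by rewrite divr_ge0// ltW.
exists (fun x => K * \1_A x)%R; split.
- apply: bounded_measurableZ; split => //; exists 1%R => x.
  by rewrite indicE; case: (_ \in _); rewrite ?normr1 ?normr0.
- rewrite -[leRHS](integral_probability_cst Q 1).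
  rewrite le_eqVlt; apply/orP; left; apply/eqP.
  apply: ge0_ae_eq_integral => //.
  + apply/measurable_EFinP; apply: measurableT_comp => //.
    exact: measurable_funM.
  + exists A; split => // x /=; apply: contra_notP => Ax _.
    by rewrite indicE memNset// mulr0 expR0.
- under eq_integral do rewrite EFinM.
  rewrite ge0_integralZl_EFin//; last exact/measurable_EFinP.
  rewrite integral_indic// setIT.
  have MKPA : `|M|%:E = K%:E * P A.
    by rewrite -[P A]fineK// -EFinM /K divfK ?gt_eqF.
  by apply: (@le_trans _ _ `|M|%:E); rewrite ?lee_fin ?ler_norm// MKPA.
Qed.

(** The ideal choice is [lne h], whose exponential [h] has [Q]-mean 1. Clipping it to [[-n, n]]
    raises that mean to at most [1 + e n], and subtracting [ln (1 + e n)] restores the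
    normalization. *)
Let kl_approx_dominated M : P `<< Q -> M%:E < kl_divergence P Q ->
  exists g : T -> R,
  [/\ bounded_measurable g, \int[Q]_x (expR (g x))%:E <= 1 &
      M%:E <= \int[P]_x (g x)%:E].
Proof.
move=> PQ; have [h dh] := dominates_density PQ; have [mh h0 PE] := dh.
rewrite (kl_divergence_density dh) => Mkl.
pose e n : R := expR (- n%:R).
(* It suffices to leave room for the loss [e n], since [ln (1 + e n) <= e n]. *)
suff [n Mn] : exists n, M%:E < \int[P]_x mine (lne (h x)%:E) n%:R%:E - (e n)%:E.
  pose w x := clip n%:R n%:R (lne (h x)%:E).
  have mw : measurable_fun [set: T] w.
    exact: measurableT_comp (@measurable_clip R _ _) (measurable_lne_comp mh).
  have bw : bounded_measurable w.
    by split => //; exists (n%:R + n%:R)%R => x; exact: clip_bounded.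
  have e0 : (0 < 1 + e n)%R by rewrite ltr_wpDl// expR_gt0.
  exists (fun x => w x + - ln (1 + e n))%R; split.
  - by apply: bounded_measurableD => //; exact: bounded_measurable_cst.
  - under eq_integral do rewrite expRD mulrC expRN lnK ?posrE// EFinM.
    rewrite ge0_integralZl_EFin//; last 2 first.
    + by apply/measurable_EFinP; exact: measurableT_comp.
    + by rewrite invr_ge0 ltW.
    rewrite muleC lee_pdivrMr// mul1e EFinD.
    apply: (@le_trans _ _ (\int[Q]_x ((h x)%:E + (e n)%:E))).
      apply: ge0_le_integral => //.
      + by apply/measurable_EFinP; exact: measurableT_comp.
      + by apply/measurable_EFinP; exact: measurable_funD.
      + move=> x _; have := expR_clip_le n%:R n%:R (lne (h x)%:E) (@ltr01 R).
        rewrite invr1 !mul1r mul1e => /le_trans; apply; apply: leeD => //.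
        apply: (@le_trans _ _ (expeR (lne (h x)%:E))).
          by rewrite lee_expeR ge_min lexx.
        by rewrite lneK// in_itv/= leey lee_fin h0.
    rewrite ge0_integralD//; last 3 first.
    + by move=> x _; rewrite lee_fin.
    + exact/measurable_EFinP.
    + by move=> x _; rewrite lee_fin expR_ge0.
    rewrite integral_probability_cst; apply: leeD => //.
    by rewrite -PE//; exact: probability_le1.
  - under eq_integral do rewrite EFinD.
    rewrite integralD//; last 2 first.
      by apply: bounded_measurable_integrable => //; exact: probabilityT_lty.
      by apply: bounded_measurable_integrable;
        [exact: probabilityT_lty|exact: bounded_measurable_cst].
    rewrite integral_probability_cst; apply: (le_trans (ltW Mn)).
    apply: leeD; last first.
      rewrite lee_fin lerN2; apply: le_ln1Dx.
      by apply: lt_trans (expR_gt0 _); rewrite oppr_lt0.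
    apply: ae_le_integral.
    + by apply: measurable_mine => //; exact: measurable_lne_comp.
    + exact/measurable_EFinP.
    + by apply: aeW => x; exact: mine_le_clip.
(* If no [n] worked, the limit in [n] would make the divergence at most [M]. *)
apply/not_existsP => H; move: Mkl; apply/negP; rewrite -leNgt.
rewrite -[leLHS]sube0.
apply: (@cvge_le _ \oo _ _
  (fun n => \int[P]_x mine (lne (h x)%:E) n%:R%:E - (e n)%:E)).
  by apply: nearW => n; rewrite leNgt; apply/negP/H.
apply: cvgeB; first by rewrite fin_num_adde_defl// fin_numN.
  exact: cvg_integral_mine (measurable_lne_comp mh).
by apply/cvg_EFin; [exact: nearW|exact: cvgn_expR].
Qed.

Lemma kl_divergence_approx M : M%:E < kl_divergence P Q ->
  exists g : T -> R,
  [/\ bounded_measurable g, \int[Q]_x (expR (g x))%:E <= 1 &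
      M%:E <= \int[P]_x (g x)%:E].
Proof.
by case: (pselect (P `<< Q)) => [/kl_approx_dominated|/kl_approx_singular];
  [exact|move=> /(_ M)].
Qed.

End kl_divergence_approx.

(** * Integration against a kernel and against its output distribution *)

Section kernel_integral.
Context d d' (X : measurableType d) (Y : measurableType d') (R : realType).
Variable k : R.-pker X ~> Y.

Lemma measurable_integral_kernel (f : Y -> \bar R) :
  measurable_fun [set: Y] f ->
  measurable_fun [set: X] (fun x => \int[k x]_y f y).
Proof.
move=> mf; under eq_fun do rewrite integralE; apply: emeasurable_funB.
- apply: measurable_fun_integral_kernel => //; first exact: measurable_kernel.
  exact: measurable_funepos.
- apply: measurable_fun_integral_kernel => //; first exact: measurable_kernel.
  exact: measurable_funeneg.
Qed.

Lemma kernelT_lty x : k x [set: Y] < +oo.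
Proof. by rewrite prob_kernel ltry. Qed.

Definition kmean (g : Y -> R) x : R := fine (\int[k x]_y (g y)%:E).

Lemma kmeanE g x : bounded_measurable g ->
  (kmean g x)%:E = \int[k x]_y (g y)%:E.
Proof.
move=> bg; rewrite fineK//; apply: integral_bounded_fin_num => //.
exact: kernelT_lty.
Qed.

Lemma bounded_measurable_kmean g : bounded_measurable g ->
  bounded_measurable (kmean g).
Proof.
move=> bg; have [mg [K gK]] := bg; split.
  apply: measurableT_comp; first exact: fine_measurable.
  by apply: measurable_integral_kernel; exact/measurable_EFinP.
exists K => x; rewrite ler_norml -!lee_fin kmeanE//.
have cstK r : \int[k x]_y r%:E = r%:E.
  by rewrite integral_cst// prob_kernel mule1.
have gE : measurable_fun [set: Y] (EFin \o g) by exact/measurable_EFinP.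
apply/andP; split.
  rewrite -[leLHS](cstK (- K)%R); apply: ae_le_integral => //.
  by apply: aeW => y; rewrite lee_fin; have := gK y; rewrite ler_norml => /andP[].
rewrite -[leRHS](cstK K); apply: ae_le_integral => //.
by apply: aeW => y; rewrite lee_fin; exact: le_trans (ler_norm _) (gK y).
Qed.

Import HBNNSimple.

Let integral_output_nnsfun (P : probability X R) (h : {nnsfun Y >-> R}) :
  \int[output_distribution P k]_y (h y)%:E =
  \int[P]_x \int[k x]_y (h y)%:E.
Proof.
rewrite integralT_nnsfun sintegralE.
under [RHS]eq_integral do rewrite integralT_nnsfun sintegralE.
rewrite ge0_integral_fsum//; last 2 first.
- by move=> r; apply: measurable_funeM; exact: measurable_kernel.
- by move=> n x _; exact: nnsfun_mulemu_ge0.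
apply: eq_fsbigr => // r rh; rewrite integralZl//.
apply: (le_integrable _ _ _ (finite_measure_integrable_cst P 1 measurableT)) => //.
  exact: measurable_kernel.
move=> x _ /=; rewrite normr1 gee0_abs// -[leRHS](@prob_kernel _ _ _ _ _ k x).
by rewrite le_measure// ?inE.
Qed.

(** Simple functions increase to [f]; monotone convergence is used against the output distribution,
    against each [k x], and against [P]. *)
Lemma ge0_integral_output_distribution (P : probability X R) (f : Y -> \bar R) :
  measurable_fun [set: Y] f -> (forall y, 0 <= f y) ->
  \int[output_distribution P k]_y f y = \int[P]_x \int[k x]_y f y.
Proof.
move=> mf f0; pose g n y := (nnsfun_approx measurableT mf n y)%:E.
have mg n : measurable_fun [set: Y] (g n) by exact/measurable_EFinP.
have g0 n y : [set: Y] y -> 0 <= g n y by rewrite lee_fin.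
have ndg y : [set: Y] y -> {homo g ^~ y : n m / (n <= m)%N >-> n <= m}.
  by move=> _ n m nm; rewrite lee_fin; exact/lefP/nd_nnsfun_approx.
have gf y : f y = limn (g ^~ y).
  by apply/esym/cvg_lim => //; exact: cvg_nnsfun_approx.
transitivity (limn (fun n => \int[output_distribution P k]_y g n y)).
  by rewrite -monotone_convergence//; apply: eq_integral => y _; rewrite gf.
transitivity (limn (fun n => \int[P]_x \int[k x]_y g n y)).
  by congr (limn _); apply/funext => n; rewrite integral_output_nnsfun.
rewrite -monotone_convergence//.
- apply: eq_integral => x _; rewrite -monotone_convergence//.
  by apply: eq_integral => y _; rewrite gf.
- by move=> n; exact: measurable_integral_kernel.
- by move=> n x _; apply: integral_ge0 => y _; exact: g0.
- move=> x _ n m nm; apply: ge0_le_integral => // y _.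
    exact: g0.
  exact: ndg.
Qed.

(** Adding the bound [K] reduces to the nonnegative case; [K] then cancels, as it integrates to
    itself under every probability involved. *)
Lemma integral_output_distribution (P : probability X R) (g : Y -> R) :
  bounded_measurable g ->
  \int[output_distribution P k]_y (g y)%:E = \int[P]_x (kmean g x)%:E.
Proof.
move=> bg; have [mg [K gK]] := bg.
have gK0 y : 0 <= (g y + K)%:E.
  by rewrite lee_fin -lerBlDr sub0r; have := gK y; rewrite ler_norml => /andP[].
have mgK : measurable_fun [set: Y] (fun y => (g y + K)%:E).
  by apply/measurable_EFinP; exact: measurable_funD.
have := ge0_integral_output_distribution P mgK gK0.
under [X in _ = X]eq_integral => x _.
  rewrite (_ : \int[k x]_y _ = (kmean g x)%:E + K%:E); last first.
    under eq_integral do rewrite EFinD.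
    rewrite integralD//; last 2 first.
    - exact: bounded_measurable_integrable (kernelT_lty _) bg.
    - apply: bounded_measurable_integrable (kernelT_lty _) _.
      exact: bounded_measurable_cst.
    by rewrite -kmeanE// integral_cst// prob_kernel mule1.
  over.
under [X in X = _]eq_integral do rewrite EFinD.
rewrite !integralD//; last 4 first.
1-4: apply: bounded_measurable_integrable (probabilityT_lty _) _ => //;
  first [exact: bounded_measurable_kmean|exact: bounded_measurable_cst].
by rewrite !integral_probability_cst => /(congr1 (fun z => z - K%:E));
  rewrite !addeK.
Qed.

End kernel_integral.

(** * Tilted measures *)

Section tilting.
Context d (T : measurableType d) (R : realType).

Section density_measure.
Variables (Q : probability T R) (h : T -> R).
Hypotheses (mh : measurable_fun [set: T] h) (h0 : forall x, (0 <= h x)%R).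
Hypothesis h1 : \int[Q]_x (h x)%:E = 1.

(* The hypotheses are arguments so that they can be recovered from the measure
   when its canonical structures are inferred. *)
Definition density_measure of measurable_fun [set: T] h &
  (forall x, (0 <= h x)%R) & \int[Q]_x (h x)%:E = 1 :=
  fun A => \int[Q]_(x in A) (h x)%:E.

Local Notation mu := (density_measure mh h0 h1).

Let mu0 : mu set0 = 0. Proof. exact: integral_set0. Qed.

Let mu_ge0 A : 0 <= mu A.
Proof. by apply: integral_ge0 => x _; rewrite lee_fin. Qed.

Let mu_sigma_additive : semi_sigma_additive mu.
Proof.
apply: semi_sigma_additive_nng_induced; first exact/measurable_EFinP.
by move=> x; rewrite lee_fin.
Qed.

HB.instance Definition _ := isMeasure.Build _ _ _ mu
  mu0 mu_ge0 mu_sigma_additive.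

HB.instance Definition _ := Measure_isProbability.Build _ _ _ mu h1.

Lemma exists_probability_density : exists P, is_density P Q h.
Proof. by exists mu. Qed.

End density_measure.

(** The easy half of the Donsker-Varadhan formula: [kl_divergence_ge] for [F = exp g / z], whose
    [Q]-integral is 1, so that [+ 1] and [- 1] cancel. *)
Lemma kl_divergence_ge_bounded (P Q : probability T R) g :
  bounded_measurable g ->
  \int[P]_x (g x)%:E - (ln (fine (\int[Q]_x (expR (g x))%:E)))%:E <=
    kl_divergence P Q.
Proof.
move=> bg; have [mg _] := bg.
have bexp := bounded_measurable_expR bg.
set z := fine _.
have zE : z%:E = \int[Q]_x (expR (g x))%:E.
  by rewrite fineK// integral_bounded_fin_num//; exact: probabilityT_lty.
have z0 : (0 < z)%R by rewrite -lte_fin zE integral_expR_gt0.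
have bgz : bounded_measurable (fun x => g x + - ln z)%R.
  by apply: bounded_measurableD => //; exact: bounded_measurable_cst.
have iP (g' : T -> R) : bounded_measurable g' ->
    P.-integrable [set: T] (EFin \o g').
  exact: bounded_measurable_integrable (probabilityT_lty P).
have lneE : (fun x => lne (expR (g x + - ln z))%:E) =
    (fun x => (g x + - ln z)%:E).
  by apply/funext => x; rewrite -[(expR _)%:E]/(expeR (_ %:E)) expeRK.
have := @kl_divergence_ge _ _ _ P Q (fun x => expR (g x + - ln z)).
rewrite lneE.
have -> : \int[Q]_x (expR (g x + - ln z))%:E = 1.
  under eq_integral do rewrite expRD mulrC expRN lnK ?posrE// EFinM.
  rewrite ge0_integralZl_EFin//; last 2 first.
    by apply/measurable_EFinP; exact: measurableT_comp.
    by rewrite invr_ge0 ltW.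
  by rewrite -zE -EFinM mulVf// gt_eqF.
under eq_integral do rewrite EFinD.
rewrite integralD//; last 2 first.
- exact: iP.
- by apply: iP; exact: bounded_measurable_cst.
rewrite integral_probability_cst addeK//; apply.
- by apply: measurableT_comp => //; exact: measurable_funD.
- by move=> x; exact: expR_ge0.
- exact: iP.
Qed.

End tilting.

(** * Finite products and weighted sums of extended reals *)

Section extended_products.
Context (R : realType) (I : Type) (r : seq I).

Lemma lee_prod (a b : I -> \bar R) :
  (forall i, 0 <= a i) -> (forall i, a i <= b i) ->
  \prod_(i <- r) a i <= \prod_(i <- r) b i.
Proof.
move=> a0 ab; suff [] : 0 <= \prod_(i <- r) a i /\
  \prod_(i <- r) a i <= \prod_(i <- r) b i by [].
elim: r => [|i s [IH0 IH]]; first by rewrite !big_nil.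
by rewrite !big_cons mule_ge0// lee_pmul.
Qed.

Lemma cvg_prodr (u : I -> R^nat) (a : I -> R) :
  (forall i, u i n @[n --> \oo] --> a i) ->
  (\prod_(i <- r) u i n)%R @[n --> \oo] --> (\prod_(i <- r) a i)%R.
Proof.
move=> ua; elim: r => [|i s IH].
  by rewrite big_nil; under eq_fun do rewrite big_nil; exact: cvg_cst.
by rewrite big_cons; under eq_fun do rewrite big_cons; exact: cvgM.
Qed.

Lemma prodEFin (a : I -> R) :
  \prod_(i <- r) (a i)%:E = (\prod_(i <- r) a i)%:E.
Proof. by elim/big_rec2 : _ => // i x y _ ->. Qed.

End extended_products.

(** Lets all the [a j] be approximated from below at once, infinite ones included. Nonnegativity
    excludes [-oo] and leaves -1 available as a strict lower bound. *)
Lemma sum_le_approx (R : realType) (m : nat) (c : 'I_m -> R)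
    (a : 'I_m -> \bar R) (B : \bar R) :
  (forall j, (0 < c j)%R) -> (forall j, 0 <= a j) ->
  (forall M : 'I_m -> R, (forall j, (M j)%:E < a j) ->
    (\sum_(j < m) c j * M j)%:E <= B) ->
  \sum_(j < m) (c j)%:E * a j <= B.
Proof.
move=> c0 a0 aB; pose C := (\sum_(j < m) c j)%R.
have C0 : (0 <= C)%R by apply: sumr_ge0 => j _; exact: ltW.
have [afin|/existsNP[i ai]] := pselect (forall j, a j \is a fin_num).
  apply/lee_addgt0Pr => e e0.
  (* Lowering each [a j] by [e / (C + 1)] costs at most [e] in total, since the weights sum to
     [C]. *)
  have Ce : (0 < e / (C + 1))%R by rewrite divr_gt0// ltr_wpDl.
  have := aB (fun j => fine (a j) - e / (C + 1))%R.
  under eq_bigr do rewrite mulrBr.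
  rewrite sumrB -mulr_suml -/C => H.
  rewrite (eq_bigr (fun j => (c j * fine (a j))%:E)); last first.
    by move=> j _; rewrite EFinM fineK.
  rewrite sumEFin -leeBlDr//; apply: le_trans (H _).
    rewrite -EFinB lee_fin lerB// mulrA ler_pdivrMr ?ltr_wpDl//.
    by rewrite mulrDr mulr1 mulrC lerDl ltW.
  by move=> j; rewrite -[ltRHS]fineK// lte_fin ltrBlDr ltrDl.
have ay : a i = +oo.
  by apply/eqP; move: ai (a0 i); rewrite fin_numE; case: (a i) => [r| |].
suff -> : B = +oo by rewrite leey.
apply/eqyP => A A0.
(* The other terms contribute minus the sum of their weights, that is [c i - C], so the whole sum is
   [A + c i]. *)
pose M j := if j == i then ((A + C) / c i)%R else (-1)%R.
apply: le_trans (aB M _); last first.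
  move=> j; rewrite /M; case: eqP => [->|_]; first by rewrite ay ltry.
  by apply: lt_le_trans (a0 j); rewrite lte_fin ltrN10.
have CE : (C = c i + \sum_(j < m | j != i) c j)%R by rewrite /C (bigD1 i).
rewrite lee_fin (bigD1 i)//= {1}/M eqxx mulrC divfK ?gt_eqF//.
rewrite (eq_bigr (fun j => - c j)%R); last first.
  by move=> j /negbTE ji; rewrite /M ji mulrN1.
by rewrite sumrN CE; have := c0 i; lra.
Qed.

(** * Equivalence with the bounded inequality *)

Section duality.
Context (R : realType) (m : nat) (dX : measure_display) (X : measurableType dX)
  (dY : 'I_m -> measure_display) (Y : forall j : 'I_m, measurableType (dY j))
  (QX : probability X R) (d : R)
  (k : forall j : 'I_m, R.-pker X ~> Y j)
  (RY : forall j : 'I_m, probability (Y j) R)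
  (c : 'I_m -> R).
Hypothesis hc : forall j, (0 < c j)%R.

Definition functional_inequality :=
  forall f : forall j : 'I_m, Y j -> R,
     (forall j, measurable_fun [set: Y j] (f j)) ->
     (forall j y, (0 <= f j y)%R) ->
     {ae QX, forall x,
        (forall j, integral_defined (k j x) (fun y => lne (f j y)%:E)) /\
        sum_defined (fun j => cond_log (k j) (f j) x)} ->
     prod_defined (fun j => 'N[RY j]_((c j)^-1%:E)[EFin \o f j]) ->
     \int[QX]_x expeR (\sum_(j < m) cond_log (k j) (f j) x - d%:E)
       <= \prod_(j < m) 'N[RY j]_((c j)^-1%:E)[EFin \o f j].

Definition entropy_inequality :=
  forall PX : probability X R, PX `<< QX ->
     \sum_(j < m) (c j)%:E *
        kl_divergence (output_distribution PX (k j)) (RY j)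
       <= kl_divergence PX QX + d%:E.

(** For bounded [g], the exponent in 1) of the functions [exp (c j * g j)]. *)
Definition exponent (g : forall j, Y j -> R) (x : X) : R :=
  (\sum_(j < m) c j * kmean (k j) (g j) x - d)%R.

Definition bounded_inequality :=
  forall g : forall j, Y j -> R, (forall j, bounded_measurable (g j)) ->
  \int[QX]_x (expR (exponent g x))%:E <=
    \prod_(j < m) ((\int[RY j]_y (expR (g j y))%:E) `^ c j).

Lemma bounded_measurable_exponent g : (forall j, bounded_measurable (g j)) ->
  bounded_measurable (exponent g).
Proof.
move=> bg; apply: bounded_measurableD; last exact: bounded_measurable_cst.
apply: bounded_measurable_sum => j; apply: bounded_measurableZ.
exact: bounded_measurable_kmean.
Qed.

Lemma integral_exponent (P : probability X R) g :
  (forall j, bounded_measurable (g j)) ->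
  \int[P]_x (exponent g x)%:E =
  \sum_(j < m) (c j)%:E * \int[output_distribution P (k j)]_y (g j y)%:E
    - d%:E.
Proof.
move=> bg.
have bk j := bounded_measurable_kmean (k j) (bg j).
have iP (g' : X -> R) : bounded_measurable g' ->
    P.-integrable [set: X] (EFin \o g').
  exact: bounded_measurable_integrable (probabilityT_lty P).
under eq_integral do rewrite EFinD.
rewrite integralD//; last 2 first.
- apply: iP; apply: bounded_measurable_sum => j.
  exact: bounded_measurableZ.
- by apply: iP; exact: bounded_measurable_cst.
rewrite integral_probability_cst; congr (_ + _).
under eq_integral do rewrite -sumEFin.
rewrite integral_sum//; last first.
  by move=> j; apply: iP; exact: bounded_measurableZ.
apply: eq_bigr => j _; under eq_integral do rewrite EFinM.
by rewrite integralZl ?integral_output_distribution//; exact: iP.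
Qed.

Lemma LnormE j (f : Y j -> R) : (forall y, (0 <= f y)%R) ->
  'N[RY j]_((c j)^-1%:E)[EFin \o f] =
  (\int[RY j]_y ((f y) `^ (c j)^-1)%:E) `^ c j.
Proof.
move=> f0; rewrite unlock invrK; congr (_ `^ _).
by apply: eq_integral => y _; rewrite /= ger0_norm.
Qed.

(** For [f j = exp (c j * g j)] the power [1 / c j] in the norm gives back [exp (g j)]. Boundedness
    makes all conditional means and norms finite, which settles the well-definedness conditions. *)
Lemma functional_bounded : functional_inequality -> bounded_inequality.
Proof.
move=> H g bg.
pose f j y := expR (c j * g j y).
have f0 j y : (0 <= f j y)%R by exact: expR_ge0.
have lnf j : (fun y => lne (f j y)%:E) = (fun y => (c j * g j y)%:E).
  by apply/funext => y; rewrite -[(f j y)%:E]/(expeR (_ %:E)) expeRK.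
have bcg j : bounded_measurable (fun y => c j * g j y)%R.
  exact: bounded_measurableZ.
have ikcg j x := bounded_measurable_integrable (kernelT_lty (k j) x) (bcg j).
have clE j x : cond_log (k j) (f j) x = (c j * kmean (k j) (g j) x)%:E.
  rewrite /cond_log lnf; under eq_integral do rewrite EFinM.
  rewrite integralZl//; last first.
    exact: bounded_measurable_integrable (kernelT_lty _ _) (bg j).
  by rewrite -kmeanE.
have NE j : 'N[RY j]_((c j)^-1%:E)[EFin \o f j] =
    (\int[RY j]_y (expR (g j y))%:E) `^ c j.
  rewrite LnormE//; congr (_ `^ _); apply: eq_integral => y _.
  by rewrite /f -expRM mulrAC divff ?mul1r// gt_eqF.
have := H f; under eq_integral.
  move=> x _; under eq_bigr do rewrite clE.
  rewrite sumEFin -EFinB -[expeR _]/((expR (exponent g x))%:E).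
  over.
under eq_bigr do rewrite NE.
apply => //.
- by move=> j; apply: measurableT_comp => //; case: (bcg j).
- apply: aeW => x; split.
    move=> j; rewrite /integral_defined lnf fin_num_adde_defl// fin_numN.
    exact: integrable_neg_fin_num.
  by move=> i j; rewrite !clE.
- move=> i j; rewrite !NE; apply: mule_def_fin; apply: fin_num_poweR;
    apply: integral_bounded_fin_num (probabilityT_lty _) _;
    exact: bounded_measurable_expR.
Qed.

(** For any [M j] below the output divergences, choose normalized [g j] with output means at least
    [M j]. Each factor on the right of the bounded inequality is then at most 1, so [ln b <= 0], and
    the variational bound for the exponent gives [D(P||Q)] at least the sum of the [c j * M j],
    minus [d]. *)
Lemma bounded_entropy : bounded_inequality -> entropy_inequality.
Proof.
move=> H P PQ; apply: sum_le_approx => //.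
  by move=> j; exact: kl_divergence_ge0.
move=> M klM.
pose g j := projT1 (cid (kl_divergence_approx (klM j))).
have gP j : [/\ bounded_measurable (g j),
    \int[RY j]_y (expR (g j y))%:E <= 1 &
    (M j)%:E <= \int[output_distribution P (k j)]_y (g j y)%:E].
  exact: projT2 (cid (kl_divergence_approx (klM j))).
have bg j : bounded_measurable (g j) by case: (gP j).
have be := bounded_measurable_exponent bg.
have := kl_divergence_ge_bounded P QX be.
set b := \int[QX]_x _.
have bfin : b \is a fin_num.
  apply: integral_bounded_fin_num (probabilityT_lty _) _.
  exact: bounded_measurable_expR.
have b1 : b <= 1.
  apply: le_trans (H _ bg) _.
  have p1 : \prod_(j < m) (1 : \bar R) = 1 by rewrite big1_eq.
  rewrite -[leRHS]p1.
  apply: lee_prod => j; first exact: poweR_ge0.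
  have [_ Z1 _] := gP j; rewrite -(poweR1r (c j)).
  apply: gt0_ler_poweR => //; first exact: ltW.
  - by rewrite in_itv/= leey integral_ge0// => y _; rewrite lee_fin expR_ge0.
  - by rewrite in_itv/= leey lee01.
have lnb : (ln (fine b) <= 0)%R.
  by apply: ln_le0; rewrite -lee_fin fineK.
move=> kle; rewrite -leeBlDr//; apply: le_trans kle.
rewrite integral_exponent// -sumEFin.
apply: (@le_trans _ _ (\sum_(j < m) (c j)%:E *
    \int[output_distribution P (k j)]_y (g j y)%:E - d%:E)).
  apply: leeB => //; apply: lee_sum => j _; rewrite EFinM lee_wpmul2l//.
    by rewrite lee_fin ltW.
  by case: (gP j).
by rewrite leeDl// -EFinN lee_fin oppr_ge0.
Qed.

(** The entropy inequality is tested on the measure with density [exp (exponent g) / b], for which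
    the variational bound on the input divergence is attained. *)
Lemma entropy_bounded : entropy_inequality -> bounded_inequality.
Proof.
move=> H g bg.
have be := bounded_measurable_exponent bg.
have [me _] := be.
set b := fine (\int[QX]_x (expR (exponent g x))%:E).
have bE : b%:E = \int[QX]_x (expR (exponent g x))%:E.
  rewrite fineK//; apply: integral_bounded_fin_num (probabilityT_lty _) _.
  exact: bounded_measurable_expR.
have b0 : (0 < b)%R by rewrite -lte_fin bE integral_expR_gt0.
pose h x := expR (exponent g x - ln b).
have mh : measurable_fun [set: X] h.
  by apply: measurableT_comp => //; exact: measurable_funB.
have h1 : \int[QX]_x (h x)%:E = 1.
  under eq_integral do rewrite /h expRD mulrC expRN lnK ?posrE// EFinM.
  rewrite ge0_integralZl_EFin//; last 2 first.
    by apply/measurable_EFinP; exact: measurableT_comp.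
    by rewrite invr_ge0 ltW.
  by rewrite -bE -EFinM mulVf// gt_eqF.
have [P dP] := exists_probability_density mh (fun x => expR_ge0 _) h1.
have := H P (density_dominates dP).
have -> : kl_divergence P QX = \int[P]_x (exponent g x)%:E - (ln b)%:E.
  rewrite (kl_divergence_density dP).
  under eq_integral do rewrite -[(h _)%:E]/(expeR (_ %:E)) expeRK EFinB.
  rewrite integralB//; last 2 first.
  - exact: bounded_measurable_integrable (probabilityT_lty _) be.
  - apply: bounded_measurable_integrable (probabilityT_lty _) _.
    exact: bounded_measurable_cst.
  by rewrite integral_probability_cst.
rewrite integral_exponent//.
pose I j := fine (\int[output_distribution P (k j)]_y (g j y)%:E).
pose Z j := fine (\int[RY j]_y (expR (g j y))%:E).
have IE j : (I j)%:E = \int[output_distribution P (k j)]_y (g j y)%:E.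
  by rewrite fineK//; exact: integral_bounded_fin_num (probabilityT_lty _) _.
have ZE j : (Z j)%:E = \int[RY j]_y (expR (g j y))%:E.
  rewrite fineK//; apply: integral_bounded_fin_num (probabilityT_lty _) _.
  exact: bounded_measurable_expR.
have Z0 j : (0 < Z j)%R by rewrite -lte_fin ZE integral_expR_gt0.
under [X in _ <= X - _ - _ + _]eq_bigr do rewrite -IE -EFinM.
rewrite sumEFin -!EFinB -EFinD => Hkl.
(* Each output divergence is at least [I j - ln (Z j)]. The means [I j] and the constant [d] then
   cancel, leaving [ln b] at most the sum of the [c j * ln (Z j)], to be exponentiated. *)
have : (\sum_(j < m) c j * (I j - ln (Z j)))%:E <=
    (\sum_(j < m) c j * I j - d - ln b + d)%:E.
  apply: le_trans Hkl; rewrite -sumEFin; apply: lee_sum => j _.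
  rewrite EFinM; apply: lee_wpmul2l; first by rewrite lee_fin ltW.
  rewrite EFinB IE.
  exact: kl_divergence_ge_bounded.
rewrite lee_fin; under eq_bigr do rewrite mulrBr.
rewrite sumrB => Hln.
have {}Hln : (ln b <= \sum_(j < m) c j * ln (Z j))%R by lra.
under eq_bigr do rewrite -ZE poweR_EFin.
rewrite prodEFin -bE lee_fin -[leLHS]lnK ?posrE//.
apply: le_trans (_ : (expR (\sum_(j < m) c j * ln (Z j)) <= _)%R).
  by rewrite ler_expR.
rewrite expR_sum le_eqVlt; apply/orP; left; apply/eqP/eq_bigr => j _.
by rewrite /powR gt_eqF.
Qed.

End duality.

(** * From bounded functions to general ones, by truncating logarithms *)

Lemma cvg_powR_expR (R : realType) (z c : R) : (0 <= z)%R -> (0 < c)%R ->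
  ((z + expR (- n%:R)) `^ c)%R @[n --> \oo] --> (z `^ c)%R.
Proof.
move=> z0 c0.
(* Zero is treated apart, since continuity of [ln] is available only at positive points; there the
   sequence is [exp (- n c)]. *)
have [zE|zN0] := eqVneq z 0%R.
  rewrite zE powR0 ?gt_eqF//.
  have -> : (fun n => ((0 + expR (- n%:R)) `^ c)%R) =
      (fun x : R => expR (- x)) \o (fun n => n%:R * c)%R.
    by apply/funext => n /=; rewrite add0r -expRM mulNr.
  apply: (cvg_comp _ _ _ (@cvgr_expR R)).
  apply/cvgryPge => A; apply: filterS (nbhs_infty_ger (A / c)) => n.
  by rewrite ler_pdivrMr.
have zgt0 : (0 < z)%R by rewrite lt_neqAle eq_sym zN0.
have powE x : (0 < x)%R -> (x `^ c = expR (c * ln x))%R.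
  by move=> x0; rewrite /powR gt_eqF.
rewrite powE//.
have -> : (fun n => ((z + expR (- n%:R)) `^ c)%R) =
    (fun n => expR (c * ln (z + expR (- n%:R)))).
  by apply/funext => n; rewrite powE// ltr_wpDr// expR_ge0.
have zE : (z + expR (- n%:R))%R @[n --> \oo] --> z.
  rewrite -[X in _ --> X]addr0; apply: cvgD; first exact: cvg_cst.
  exact: cvgn_expR.
have lnE : ln (z + expR (- n%:R)) @[n --> \oo] --> ln z.
  exact: continuous_cvg (continuous_ln zgt0) zE.
apply: continuous_cvg; first exact: continuous_expR.
by apply: cvgM => //; exact: cvg_cst.
Qed.

Section truncation.
Context (R : realType) (m : nat) (dX : measure_display) (X : measurableType dX)
  (dY : 'I_m -> measure_display) (Y : forall j : 'I_m, measurableType (dY j))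
  (QX : probability X R) (d : R)
  (k : forall j : 'I_m, R.-pker X ~> Y j)
  (RY : forall j : 'I_m, probability (Y j) R)
  (c : 'I_m -> R).
Hypothesis hc : forall j, (0 < c j)%R.
Hypothesis H : bounded_inequality QX d k RY c.
Variable f : forall j : 'I_m, Y j -> R.
Arguments f : clear implicits.
Hypothesis mf : forall j, measurable_fun [set: Y j] (f j).
Hypothesis f0 : forall j y, (0 <= f j y)%R.

Let l j y : \bar R := lne (f j y)%:E.

Let ml j : measurable_fun [set: Y j] (@l j).
Proof. exact: measurable_lne_comp. Qed.

(** Cut off from above only: the value stays [-oo] where [f] vanishes. *)
Let ln_trunc n j (y : Y j) : \bar R := mine (l y) n%:R%:E.

Let mln n j : measurable_fun [set: Y j] (@ln_trunc n j).
Proof. exact: measurable_mine. Qed.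

Let expo n x : \bar R := \sum_(j < m) \int[k j x]_y ln_trunc n y - d%:E.

Let mexpo n : measurable_fun [set: X] (expo n).
Proof.
apply: emeasurable_funB => //; apply: emeasurable_sum => j.
exact: measurable_integral_kernel.
Qed.

(** This is [min(f, exp n)] to the power [1 / c j], with value 0 where [f] vanishes. *)
Let F n j y : \bar R := expeR ((c j)^-1%:E * ln_trunc n (y : Y j)).

Let mF n j : measurable_fun [set: Y j] (@F n j).
Proof.
apply: (measurableT_comp (@measurable_expeR R)).
exact: emeasurable_funM.
Qed.

Let Z n j := \int[RY j]_y F n y.

(** The cut-off bounds [F] by [exp (n / c j)]. Finiteness lets the limit in the lower clipping level
    be taken among real numbers. *)
Let Z_fin n j : Z n j \is a fin_num.
Proof.
rewrite ge0_fin_numE; last by apply: integral_ge0 => y _; exact: expeR_ge0.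
apply: (@le_lt_trans _ _ (expR ((c j)^-1 * n%:R))%:E); last exact: ltry.
have <- := integral_probability_cst (RY j) (expR ((c j)^-1 * n%:R)).
apply: ge0_le_integral => //.
- by move=> y _; exact: expeR_ge0.
- move=> y _; rewrite -[leRHS]/(expeR (_ * _)%:E) lee_expeR EFinM.
  apply: lee_wpmul2l; first by rewrite lee_fin invr_ge0 ltW.
  by rewrite ge_min lexx orbT.
Qed.

(** Clipping from below makes the logarithms bounded. It can only raise the exponent on the left,
    and it adds at most [exp (- b)] to each integral on the right. *)
Let trunc_bound_lower n b :
  \int[QX]_x expeR (expo n x) <=
  \prod_(j < m) ((Z n j + (expR (- b%:R))%:E) `^ c j).
Proof.
(* The lower level is proportional to [c j], so that division by [c j] leaves the same error
   [exp (- b)] for every [j]. *)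
pose w j y := clip (c j * b%:R) n%:R (l (y : Y j)).
have bw j : bounded_measurable (w j).
  split; first exact: measurableT_comp (@measurable_clip R _ _) (@ml j).
  exists (c j * b%:R + n%:R)%R => y; apply: clip_bounded => //.
  by rewrite mulr_ge0// ltW.
pose g j y := ((c j)^-1 * w j y)%R.
have bg j : bounded_measurable (g j) by exact: bounded_measurableZ.
have be := bounded_measurable_exponent d k c bg.
apply: le_trans (_ : \int[QX]_x (expR (exponent d k c g x))%:E <= _).
  apply: ge0_le_integral => //.
  - by move=> x _; exact: expeR_ge0.
  - exact: (measurableT_comp (@measurable_expeR R)).
  - by apply/measurable_EFinP; case: (bounded_measurable_expR be).
  - move=> x _; rewrite -[leRHS]/(expeR (_%:E)) lee_expeR /exponent EFinB.
    apply: leeB => //; rewrite -sumEFin; apply: lee_sum => j _.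
    rewrite EFinM kmeanE// -integralZl//; last first.
      exact: bounded_measurable_integrable (kernelT_lty _ _) (bg j).
    apply: ae_le_integral => //.
      by apply: measurable_funeM; apply/measurable_EFinP; case: (bg j).
    apply: aeW => y; rewrite -EFinM /g mulrA divff ?mul1r ?gt_eqF//.
    exact: mine_le_clip.
apply: le_trans (H bg) _; apply: lee_prod => j; first exact: poweR_ge0.
have nneg (x : \bar R) : 0 <= x -> x \in `[0, +oo].
  by move=> x0; rewrite in_itv/= x0 leey.
have eb : 0 <= (expR (- b%:R) : R)%:E by rewrite lee_fin expR_ge0.
have F0 y : 0 <= F n (y : Y j) by exact: expeR_ge0.
apply: gt0_ler_poweR; first exact: ltW.
- by apply: nneg; apply: integral_ge0 => y _; rewrite lee_fin expR_ge0.
- by apply: nneg; rewrite adde_ge0// integral_ge0.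
have <- := integral_probability_cst (RY j) (expR (- b%:R)).
rewrite /Z -ge0_integralD//.
apply: ge0_le_integral => //.
- by apply/measurable_EFinP; case: (bounded_measurable_expR (bg j)).
- exact: emeasurable_funD.
- move=> y _; have := expR_clip_le (c j * b%:R) n%:R (l y) (hc j).
  by rewrite mulrA mulVf ?mul1r// gt_eqF.
Qed.

Let trunc_bound n : \int[QX]_x expeR (expo n x) <=
  \prod_(j < m) ((Z n j) `^ c j).
Proof.
have ZE j : Z n j = (fine (Z n j))%:E by rewrite fineK.
under eq_bigr do rewrite ZE poweR_EFin.
rewrite prodEFin.
apply: (@cvge_ge _ \oo _ _ (fun b => (\prod_(j < m)
    (fine (Z n j) + expR (- b%:R)) `^ c j)%R%:E)).
  apply: nearW => b; rewrite -prodEFin.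
  under eq_bigr do rewrite -poweR_EFin EFinD -ZE.
  exact: trunc_bound_lower.
apply: cvg_EFin; first exact: nearW.
apply: cvg_prodr => j; apply: cvg_powR_expR => //.
by apply: fine_ge0; apply: integral_ge0 => y _; exact: expeR_ge0.
Qed.

Let Z_le_norm n j : (Z n j) `^ c j <= 'N[RY j]_((c j)^-1%:E)[EFin \o f j].
Proof.
rewrite LnormE//.
have nneg (x : \bar R) : 0 <= x -> x \in `[0, +oo].
  by move=> x0; rewrite in_itv/= x0 leey.
apply: gt0_ler_poweR; first exact: ltW.
- by apply: nneg; apply: integral_ge0 => y _; exact: expeR_ge0.
- by apply: nneg; apply: integral_ge0 => y _; rewrite lee_fin powR_ge0.
apply: ge0_le_integral => //.
- by move=> y _; exact: expeR_ge0.
- apply/measurable_EFinP.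
  exact: (measurableT_comp (@measurable_powR R _) (@mf j)).
move=> y _.
have c1 : (0 < (c j)^-1)%R by rewrite invr_gt0.
apply: (@le_trans _ _ (expeR ((c j)^-1%:E * l y))).
  rewrite lee_expeR; apply: lee_wpmul2l; first by rewrite lee_fin ltW.
  by rewrite ge_min lexx.
(* Where [f] vanishes the logarithm is [-oo] and the left side is 0. *)
rewrite /l; have [->|fy] := eqVneq (f j y) 0%R.
  by rewrite le0_lneNy// gt0_muleNy ?lte_fin// lee_fin powR_ge0.
have {}fy : (0 < f j y)%R by rewrite lt_neqAle eq_sym fy f0.
by rewrite lne_EFin// -EFinM lee_fin /powR gt_eqF.
Qed.

(** With no term equal to [-oo], the sum of the limits contains no [oo - oo]; terms equal to [+oo]
    are allowed. *)
Let cvg_expo x : (forall j, -oo < cond_log (k j) (f j) x) ->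
  expo n x @[n --> \oo] --> \sum_(j < m) cond_log (k j) (f j) x - d%:E.
Proof.
move=> clx; apply: cvgeB; first by rewrite fin_num_adde_defl// fin_numN.
  by apply: cvge_sum => // j; exact: cvg_integral_mine.
exact: cvg_cst.
Qed.

Let nd_expo x : {homo expo ^~ x : a b / (a <= b)%N >-> a <= b}.
Proof.
move=> a b ab; apply: leeB => //; apply: lee_sum => j _.
apply: ae_le_integral => //; apply: aeW => y.
by rewrite le_min ge_min lexx/= ge_min lee_fin ler_nat ab orbT.
Qed.

(** The truncated exponentials increase with [n], so monotone convergence passes the bound to their
    limit. The target integrand only has to lie below that limit. *)
Lemma bounded_functional :
  \int[QX]_x expeR (\sum_(j < m) cond_log (k j) (f j) x - d%:E)
    <= \prod_(j < m) 'N[RY j]_((c j)^-1%:E)[EFin \o f j].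
Proof.
have nd_exp x : {homo (fun n => expeR (expo n x)) : a b / (a <= b)%N >-> a <= b}.
  by move=> a b ab; rewrite lee_expeR nd_expo.
have mexp n : measurable_fun [set: X] (fun x => expeR (expo n x)).
  exact: (measurableT_comp (@measurable_expeR R)).
apply: (@le_trans _ _ (\int[QX]_x limn (fun n => expeR (expo n x)))).
  apply: ge0_le_integral => //.
  - by move=> x _; exact: expeR_ge0.
  - apply: (measurableT_comp (@measurable_expeR R)).
    apply: emeasurable_funB => //; apply: emeasurable_sum => j.
    exact: measurable_integral_kernel.
  - apply: emeasurable_fun_cvg mexp _ => x _.
    exact: ereal_nondecreasing_is_cvgn.
  - move=> x _; have [clx|] := pselect (forall j, -oo < cond_log (k j) (f j) x).
      rewrite le_eqVlt; apply/orP; left; apply/eqP/esym/cvg_lim => //.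
      by apply: cvg_expeR; [exact: nd_expo|exact: cvg_expo].
    (* One term [-oo] makes the whole sum [-oo] by convention, so the integrand is 0, below a limit
       of nonnegative values. *)
    move=> /existsNP[i /negP]; rewrite -leNgt leeNy_eq => /eqP cli.
    rewrite (bigD1 i)//= cli !addNye.
    apply: lime_ge; first exact: ereal_nondecreasing_is_cvgn.
    by apply: nearW => n; exact: expeR_ge0.
rewrite monotone_convergence//; last first.
  by move=> n x _; exact: expeR_ge0.
apply: lime_le.
  apply: ereal_nondecreasing_is_cvgn => a b ab; apply: ge0_le_integral => //.
  - by move=> x _; exact: expeR_ge0.
  - by move=> x _; exact: nd_exp.
apply: nearW => n; apply: le_trans (trunc_bound n) _.
by apply: lee_prod => j; [exact: poweR_ge0|exact: Z_le_norm].
Qed.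

End truncation.

Theorem theorem1 (R : realType) (m : nat) (hm : (0 < m)%N)
    (dX : measure_display) (X : measurableType dX)
    (dY : 'I_m -> measure_display) (Y : forall j : 'I_m, measurableType (dY j))
    (QX : probability X R) (d : R)
    (QYX : forall j : 'I_m, R.-pker X ~> Y j)
    (RY : forall j : 'I_m, probability (Y j) R)
    (c : 'I_m -> R) (hc : forall j, (0 < c j)%R) :
  (forall f : forall j : 'I_m, Y j -> R,
     (forall j, measurable_fun [set: Y j] (f j)) ->
     (forall j y, (0 <= f j y)%R) ->
     {ae QX, forall x,
        (forall j, integral_defined (QYX j x) (fun y => lne (f j y)%:E)) /\
        sum_defined (fun j => cond_log (QYX j) (f j) x)} ->
     prod_defined (fun j => 'N[RY j]_((c j)^-1%:E)[EFin \o f j]) ->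
     \int[QX]_x expeR (\sum_(j < m) cond_log (QYX j) (f j) x - d%:E)
       <= \prod_(j < m) 'N[RY j]_((c j)^-1%:E)[EFin \o f j])
  <->
  (forall PX : probability X R, PX `<< QX ->
     \sum_(j < m) (c j)%:E *
        kl_divergence (output_distribution PX (QYX j)) (RY j)
       <= kl_divergence PX QX + d%:E).
Proof.
split=> [H|H f mf f0 _ _].
  exact: (bounded_entropy hc (functional_bounded hc H)).
exact: (bounded_functional hc (entropy_bounded hc H) mf f0).
Qed.
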